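(* Let $m\ge2$, let $\Phi\big((w_{ij})_{1\le i<j\le m}\big)$ be a continuous function of the $\binom m2$ variables $w_{ij}\in[0,1]$, and let $a\in\mathbb R$. The following are equivalent: (i) There exists a graphon $W$ with $\Phi_W(x_1,\dots,x_m)=a$ for a.e. $(x_1,\dots,x_m)\in[0,1]^m$, but $W$ is not a.e. constant. (ii) There exists a 2-type graphon $W$ with $\Phi_W(x_1,\dots,x_m)=a$ for all $(x_1,\dots,x_m)$, but $W$ is not constant. (iii) There exist $u,v,s\in[0,1]$, not all equal, such that for every subset $A\subseteq\{1,\dots,m\}$, setting $w_{ij}=u$ if $i,j\in A$, $w_{ij}=v$ if $i,j\notin A$, and $w_{ij}=s$ if exactly one of $i,j$ is in $A$, we have $\Phi((w_{ij})_{i<j})=a$.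
   Context: A graphon is a symmetric measurable $W:[0,1]^2\to[0,1]$. $\Phi_W(x_1,\dots,x_m):=\Phi\big((W(x_i,x_j))_{i<j}\big)$. A 2-type graphon is a graphon that is constant on each set $S_i\times S_j$, $i,j\in\{1,2\}$, for some partition $[0,1]=S_1\cup S_2$ into two disjoint measurable sets. *)

(* Defs.v *)
From HB Require Import structures.
From mathcomp Require Import all_boot all_order all_algebra.
From mathcomp Require Import all_classical all_reals all_analysis.

Set Implicit Arguments.
Unset Strict Implicit.
Unset Printing Implicit Defensive.

Import Order.TTheory GRing.Theory Num.Theory.
Import numFieldNormedType.Exports.

Local Open Scope classical_set_scope.
Local Open Scope ring_scope.

Section tuple_measure.
Context {d : measure_display} {T : measurableType d} {R : realType}.
Local Open Scope ereal_scope.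

Definition tuple_cons (n : nat) (p : T * n.-tuple T) : n.+1.-tuple T :=
  [tuple of p.1 :: p.2].

(* The n-fold product measure mu \x ... \x mu on T^n, through
   T^(n+1) = T * T^n. *)
Fixpoint tuple_measure (mu : set T -> \bar R) (n : nat) :
    set (n.-tuple T) -> \bar R :=
  match n with
  | 0 => dirac [tuple]
  | n'.+1 => pushforward (mu \x @tuple_measure mu n') (@tuple_cons n')
  end.

End tuple_measure.

Arguments tuple_measure {d T R} mu n _.

Section tuple_measure_theory.
Context {d : measure_display} {T : measurableType d} {R : realType}.
Variable mu : {sigma_finite_measure set T -> \bar R}.
Local Open Scope ereal_scope.

Lemma measurable_tuple_cons n :
  measurable_fun [set: T * n.-tuple T] (@tuple_cons _ T n).
Proof. exact: measurable_cons. Qed.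

Let tuple_uncons n (t : n.+1.-tuple T) : T * n.-tuple T :=
  (thead t, [tuple of behead t]).

Let tuple_consK n : cancel (@tuple_cons _ T n) (@tuple_uncons n).
Proof. by move=> [x t]; congr pair => //; apply: val_inj. Qed.

Let measurable_tuple_uncons n :
  measurable_fun [set: n.+1.-tuple T] (@tuple_uncons n).
Proof.
apply/measurable_fun_pair; last exact: measurable_behead.
exact: measurable_tnth.
Qed.

Let sigma_finite_measure_pack d' (T' : measurableType d')
    (p : set T' -> \bar R) (p0 : p set0 = 0) (p_ge0 : forall A, 0 <= p A)
    (padd : semi_sigma_additive p) (pfin : sigma_finite setT p) :
  exists nu : {sigma_finite_measure set T' -> \bar R}, p = nu.
Proof.
pose m1 := isMeasure.Build _ _ _ p p0 p_ge0 padd.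
pose M : {measure set _ -> \bar R} := HB.pack p m1.
pose m2 := Measure_isSigmaFinite.Build _ _ _ M pfin.
pose S : {sigma_finite_measure set _ -> \bar R} :=
  HB.pack (M : set _ -> \bar R) M m2.
by exists S.
Qed.

Let tuple_measureP n :
  exists nu : {sigma_finite_measure set (n.-tuple T) -> \bar R},
    tuple_measure mu n = nu.
Proof.
elim: n => [|n [nu nuE]] /=; first by exists (\d_([tuple] : 0.-tuple T)).
rewrite nuE.
pose p := pushforward (mu \x nu) (@tuple_cons _ T n).
have p0 : p set0 = 0 by rewrite /p /pushforward preimage_set0 measure0.
have p_ge0 A : 0 <= p A by rewrite /p /pushforward measure_ge0.
have padd : semi_sigma_additive p.
  move=> F mF tF mUF; rewrite /p /pushforward preimage_bigcup.
  apply: (measure_semi_sigma_additive (fun k => @tuple_cons _ T n @^-1` F k)).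
  - by move=> k; rewrite -[X in measurable X]setTI; exact: measurable_tuple_cons.
  - apply/trivIsetP => i j _ _ ij; rewrite -preimage_setI.
    by move/trivIsetP : tF => /(_ i j Logic.I Logic.I ij) ->; rewrite preimage_set0.
  - rewrite -preimage_bigcup -[X in measurable X]setTI.
    exact: measurable_tuple_cons.
have pfin : sigma_finite setT p.
  have /sigma_finiteP[F [TF ndF Foo]] := sigma_finiteT mu.
  have /sigma_finiteP[G [TG ndG Goo]] := sigma_finiteT nu.
  exists (fun k => @tuple_uncons n @^-1` (F k `*` G k)).
    apply/seteqP; split => // t _.
    have [i _ Fi] : (\bigcup_i F i) (thead t) by rewrite -TF.
    have [j _ Gj] : (\bigcup_i G i) [tuple of behead t] by rewrite -TG.
    exists (maxn i j) => //; split => /=.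
    - by move: Fi; apply/subsetPset/ndF/leq_maxl.
    - by move: Gj; apply/subsetPset/ndG/leq_maxr.
  move=> k; have [mF Foo'] := Foo k; have [mG Goo'] := Goo k; split.
    rewrite -[X in measurable X]setTI; apply: measurable_tuple_uncons => //.
    exact: measurableX.
  rewrite /p /pushforward -comp_preimage.
  rewrite (_ : _ \o _ = idfun); last by apply/funext => t /=; rewrite tuple_consK.
  by rewrite preimage_id product_measure1E// lte_mul_pinfty// ge0_fin_numE.
exact: sigma_finite_measure_pack.
Qed.

Let tuple_measure0 n : tuple_measure mu n set0 = 0.
Proof. by have [nu ->] := tuple_measureP n; rewrite measure0. Qed.

Let tuple_measure_ge0 n A : 0 <= tuple_measure mu n A.
Proof. by have [nu ->] := tuple_measureP n; exact: measure_ge0. Qed.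

Let tuple_measure_sigma_additive n : semi_sigma_additive (tuple_measure mu n).
Proof.
have [nu ->] := tuple_measureP n; exact: measure_semi_sigma_additive.
Qed.

HB.instance Definition _ n := isMeasure.Build _ _ _ (tuple_measure mu n)
  (tuple_measure0 n) (@tuple_measure_ge0 n) (@tuple_measure_sigma_additive n).

Let tuple_measure_sigma_finite n : sigma_finite setT (tuple_measure mu n).
Proof. by have [nu ->] := tuple_measureP n; exact: sigma_finiteT. Qed.

HB.instance Definition _ n := Measure_isSigmaFinite.Build _ _ _
  (tuple_measure mu n) (@tuple_measure_sigma_finite n).

Lemma tuple_measure_box n (A : 'I_n -> set T) :
  (forall i, measurable (A i)) ->
  tuple_measure mu n [set t | forall i, A i (tnth t i)] = \prod_(i < n) mu (A i).
Proof.
elim: n A => [|n IHn] A mA.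
  rewrite big_ord0 /= diracE mem_set//= => -[].
  by [].
rewrite big_ord_recl /= /pushforward.
rewrite (_ : _ @^-1` _ = A ord0 `*`
    [set t : n.-tuple T | forall i, A (lift ord0 i) (tnth t i)]); last first.
  apply/seteqP; split => -[x t] /=.
    move=> H; split; first by have := H ord0.
    by move=> i; have := H (lift ord0 i); rewrite tnthS.
  move=> [Ax At] i; case: (unliftP ord0 i) => [j ->|->//].
  by rewrite tnthS.
rewrite product_measure1E//; first by congr (_ * _); exact: IHn.
rewrite (_ : [set t | _] = \bigcap_(i in [set: 'I_n])
    ((fun t : n.-tuple T => tnth t i) @^-1` A (lift ord0 i))); last first.
  by apply/seteqP; split => t /= H i; [move=> _|]; exact: H.
apply: fin_bigcap_measurable => // i _.
by rewrite -[X in measurable X]setTI; exact: measurable_tnth.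
Qed.

End tuple_measure_theory.

Section graphon.
Context {R : realType}.
Implicit Type W : R * R -> R.

Definition unit_itv : set R := `[0, 1]%classic.

(* A graphon is represented by a total function of which only the restriction
   to the unit square matters: every notion below only looks at that
   restriction. Measurable means Borel measurable. *)
Definition graphon W : Prop :=
  [/\ measurable_fun (unit_itv `*` unit_itv) W,
      forall x y, unit_itv x -> unit_itv y -> unit_itv (W (x, y)) &
      forall x y, unit_itv x -> unit_itv y -> W (x, y) = W (y, x)].

Definition two_type_graphon W : Prop :=
  graphon W /\
  exists S : 'I_2 -> set R,
    [/\ forall i, measurable (S i),
        trivIset setT S,
        \bigcup_i S i = unit_itv &
        forall i j, exists c : R, forall x y, S i x -> S j y -> W (x, y) = c].

Definition constant_graphon W : Prop :=
  exists c : R, forall x y, unit_itv x -> unit_itv y -> W (x, y) = c.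

Definition ae_constant_graphon W : Prop :=
  exists c : R, {ae (lebesgue_measure \x lebesgue_measure)%E,
    forall p : R * R, unit_itv p.1 -> unit_itv p.2 -> W p = c}.

(* The index set of the variables w_ij, i < j. *)
Definition edge (m : nat) : Type := {e : 'I_m * 'I_m | (e.1 < e.2)%N}.

Definition weight_cube (m : nat) : set {ptws edge m -> R} :=
  [set w | forall e, unit_itv (w e)].

Definition Phi_graphon (m : nat) (Phi : {ptws edge m -> R} -> R) W
    (x : m.-tuple R) : R :=
  Phi (fun e : edge m => W (tnth x (val e).1, tnth x (val e).2)).

Definition block_weights (m : nat) (u v s : R) (A : {set 'I_m}) :
    {ptws edge m -> R} :=
  fun e : edge m =>
    if ((val e).1 \in A) && ((val e).2 \in A) then u
    else if ((val e).1 \notin A) && ((val e).2 \notin A) then v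
    else s.

End graphon.

Arguments weight_cube {R} m _.

(* Main.v *)
(**
Only (i) => (iii) is hard. If W is not a.e. constant, there are c < d such that
E = {W <= c} and F = {W >= d} have positive measure. Points y_0, x_0, y'_0, x'_0,
y_1, x_1, ... are chosen one at a time so that any m of them, taken in any order,
avoid the null set where Phi_W differs from a, while (x_i, y_j) is in E and
(x'_i, y'_j) is in F for all j <= i. By Fubini the set of the x that are joined by
E to all the y_j chosen so far can be kept of positive measure.

For sequences p and q among x, y, x', y' put L_pq = lim_i lim_j W(p_i, q_j) along a
nonprincipal ultrafilter. Points of p and q whose mutual weights are all close to
L_pp, L_qq, L_pq can be picked greedily, so by continuity (L_pp, L_qq, L_pq)
satisfies the equations in (iii). If the triples of (y, x), (y', x') and (x, x')
were all constant, then L_yx = L_xx = L_x'x' = L_y'x', but L_yx <= c and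
L_y'x' >= d.
*)
Require Import Defs.
From HB Require Import structures.
From mathcomp Require Import all_boot all_order all_algebra fingroup perm.
From mathcomp Require Import all_classical all_reals all_analysis.

Set Implicit Arguments.
Unset Strict Implicit.
Unset Printing Implicit Defensive.

Import Order.TTheory GRing.Theory Num.Theory.
Import numFieldNormedType.Exports.

Local Open Scope classical_set_scope.
Local Open Scope ring_scope.

(** * Choice of sequences term by term *)

(** Dependent choice in which a new term may depend on all earlier ones: [Inv] lets the construction
    go on, [Step] is what is remembered about the new term. *)
Lemma history_choice (T : Type) (Inv : seq T -> Prop)
    (Step : seq T -> T -> Prop) :
  Inv [::] ->
  (forall h, Inv h -> exists z, Step h z /\ Inv (rcons h z)) ->
  exists z : nat -> T, forall n, Inv (mkseq z n) /\ Step (mkseq z n) (z n).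
Proof.
move=> Inv0 InvS.
(* [z0] only serves as the value of [F] at histories that violate [Inv]. *)
have [z0 _] := InvS _ Inv0.
have [F FP] : {F : seq T -> T &
    forall h, Inv h -> Step h (F h) /\ Inv (rcons h (F h))}.
  apply: (@choice _ _ (fun h z => Inv h -> Step h z /\ Inv (rcons h z))) => h.
  have [/InvS[z hz]|nh] := pselect (Inv h).
    by exists z.
  by exists z0.
pose hist := fix hist n := if n is k.+1 then rcons (hist k) (F (hist k)) else [::].
pose z n := F (hist n).
have histE n : hist n = mkseq z n.
  by elim: n => //= n IHn; rewrite mkseqS -IHn.
have Inv_hist n : Inv (hist n) by elim: n => //= n /FP[].
exists z => n; rewrite -histE; split=> //.
by have [] := FP _ (Inv_hist n).
Qed.

(** * Iterated limits along an ultrafilter on the natural numbers *)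

Section ultrafilter_limits.
Context {R : realType} (U : set_system nat) {UU : UltraFilter U}.

(** Compactness of the segment gives a cluster point, and an ultrafilter converges to each of its
    cluster points. *)
Lemma ultra_bounded_cvg (f : nat -> R) (a b : R) :
  (forall n, `[a, b]%classic (f n)) ->
  exists2 L, `[a, b]%classic L & f @ U --> L.
Proof.
move=> fab.
have /(@segment_compact R a b)[] : (f @ U) `[a, b]%classic by exact: nearW fab.
move=> L [abL clL]; exists L => // A nA.
have [//|UA] := in_ultra_setVsetC (f @^-1` A) UU.
by have [x [fx Ax]] := clL (~` A) A UA nA.
Qed.

Lemma ultra_iterated_limit (f : nat -> nat -> R) (a b : R) :
  (forall i j, `[a, b]%classic (f i j)) ->
  exists2 L, `[a, b]%classic L &
    forall e, 0 < e -> \forall i \near U, \forall j \near U, `|f i j - L| < e.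
Proof.
move=> fab.
have [g gP] : {g : nat -> R &
    forall i, `[a, b]%classic (g i) /\ f i @ U --> g i}.
  apply: (@choice _ _ (fun i y => `[a, b]%classic y /\ f i @ U --> y)) => i.
  by have [L ? ?] := ultra_bounded_cvg (fab i); exists L.
have [|L abL gL] := @ultra_bounded_cvg g a b; first by move=> n; have [] := gP n.
exists L => // e e0.
have e20 : 0 < e / 2 by rewrite divr_gt0.
move/cvgrPdist_lt : gL => /(_ _ e20); apply: filterS => i giL.
have [_ /cvgrPdist_lt/(_ _ e20)] := gP i; apply: filterS => j fij.
rewrite distrC (splitr e) (le_lt_trans (ler_distD (g i) _ _))//.
exact: ltrD.
Qed.

(** Greedy selection: every index [i] chosen so far has [G i j] for [U]-almost all [j], so the
    finitely many requirements on the next index hold on a set of [U], which is not empty. *)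
Lemma ultra_homogeneous (G : nat -> nat -> Prop) :
  \oo `<=` U ->
  (\forall i \near U, \forall j \near U, G i j) ->
  exists n : nat -> nat, forall i j, (i < j)%N -> (n i < n j)%N /\ G (n i) (n j).
Proof.
move=> ooU UG.
pose Inv (h : seq nat) := forall i, i \in h -> \forall j \near U, G i j.
pose Step (h : seq nat) k := forall i, i \in h -> (i < k)%N /\ G i k.
have [//||n nP] := @history_choice _ Inv Step.
- move=> h Ih.
  have : \forall k \near U, forall i : 'I_(size h),
      (nth 0 h i < k)%N /\ G (nth 0%N h i) k.
    apply: filter_forall => i; apply: filterI.
      by apply: ooU; exact: nbhs_infty_gt.
    by apply: Ih; rewrite mem_nth.
  move=> /filterI/(_ UG)/filter_ex[k [hk UGk]]; exists k; split.
    move=> i ih; have ihs : (index i h < size h)%N by rewrite index_mem.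
    by have := hk (Ordinal ihs); rewrite /= nth_index.
  by move=> i; rewrite mem_rcons inE => /predU1P[->//|/Ih].
exists n => i j ij; have [_] := nP j; apply.
by apply/mapP; exists i => //; rewrite mem_iota.
Qed.

End ultrafilter_limits.

(** * Continuity in the topology of pointwise convergence *)

Lemma ptws_cvg_coord (I : Type) (K : topologicalType)
    (F : set_system {ptws I -> K}) (f : {ptws I -> K}) :
  Filter F -> (forall i, (fun g : {ptws I -> K} => g i) @ F --> f i) -> F --> f.
Proof.
move=> FF Ff; apply/cvg_sup => i A [B [[C oC <-] Cf] BA].
apply: filterS BA _; apply: Ff; exact: open_nbhs_nbhs.
Qed.

(** Taking [e] to be 1/(n+1) gives a sequence in [D] that converges to [w0] in every coordinate and
    on which [Phi] is constantly [a]. *)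
Lemma within_continuous_approx (R : realType) (I : Type)
    (D : set {ptws I -> R}) (Phi : {ptws I -> R} -> R) (w0 : {ptws I -> R})
    (a : R) :
  {within D, continuous Phi} -> D w0 ->
  (forall e, 0 < e -> exists w, [/\ D w, forall i, `|w i - w0 i| < e & Phi w = a]) ->
  Phi w0 = a.
Proof.
move=> cPhi Dw0 H.
have [w wP] : {w : nat -> {ptws I -> R} & forall n, [/\ D (w n),
    forall i, `|w n i - w0 i| < n.+1%:R^-1 & Phi (w n) = a]}.
  apply: (@choice _ _ (fun n w => [/\ D w, forall i, `|w i - w0 i| < n.+1%:R^-1
    & Phi w = a])) => n.
  by apply: H; rewrite invr_gt0.
have ww0 : w @ \oo --> w0.
  apply: ptws_cvg_coord => i.
  suff : w n i @[n --> \oo] --> w0 i by [].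
  apply/cvgrPdist_lt => e e0.
  near=> n; rewrite distrC; have [_ /(_ i) wi _] := wP n.
  apply: lt_trans wi _; near: n.
  exact: near_infty_natSinv_lt (PosNum e0).
have : Phi \o w @ \oo --> Phi w0.
  apply: cvg_comp; last exact: cPhi.
  suff : w @ \oo --> within D (nbhs w0) by rewrite (nbhs_subspace_in Dw0).
  move=> A /= /ww0; apply: (@filterS nat) => n /=; apply.
  by have [] := wP n.
rewrite (_ : Phi \o w = cst a); last by apply/funext => n; have [] := wP n.
by move/(cvg_unique _ (cvg_cst a)) => /(_ (@norm_hausdorff _ _)).
Unshelve. all: by end_near. Qed.

(** * Block weights as limits of weights between sampled points *)

Section block_limit.
Context {R : realType} (m : nat) (Phi : {ptws edge m -> R} -> R).
Hypothesis cPhi : {within weight_cube m, continuous Phi}.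
Variables (a : R) (W : R * R -> R) (gW : graphon W).
Context (U : set_system nat) {UU : UltraFilter U}.
Hypothesis ooU : \oo `<=` U.

Lemma block_weights_cube (u v s : R) (A : {set 'I_m}) :
  unit_itv u -> unit_itv v -> unit_itv s -> weight_cube m (block_weights u v s A).
Proof. by move=> ? ? ? e; rewrite /block_weights; case: ifP => // _; case: ifP. Qed.

(* The positions in [A] receive points of [p] of small index and the other ones
   points of [q] of large index, so that every mixed pair is seen by [s] in the
   order of the two limits. *)
Lemma Phi_block_weights_limit (p q : nat -> R) (u v s : R) :
  (forall i, unit_itv (p i)) -> (forall i, unit_itv (q i)) ->
  unit_itv u -> unit_itv v -> unit_itv s ->
  (forall e, 0 < e ->
    \forall i \near U, \forall j \near U, `|W (p i, p j) - u| < e) ->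
  (forall e, 0 < e ->
    \forall i \near U, \forall j \near U, `|W (q i, q j) - v| < e) ->
  (forall e, 0 < e ->
    \forall i \near U, \forall j \near U, `|W (p i, q j) - s| < e) ->
  (forall (A : {set 'I_m}) (g : 'I_m -> nat), injective g ->
     Phi_graphon Phi W [tuple if k \in A then p (g k) else q (g k) | k < m] = a) ->
  forall A : {set 'I_m}, Phi (block_weights u v s A) = a.
Proof.
move=> pI qI uI vI sI pu qv ps good A.
have [_ WI Wsym] := gW.
apply: within_continuous_approx cPhi _ _; first exact: block_weights_cube.
move=> e e0.
pose G i j := [/\ `|W (p i, p j) - u| < e, `|W (q i, q j) - v| < e &
                  `|W (p i, q j) - s| < e].
have UG : \forall i \near U, \forall j \near U, G i j.
  move: (pu _ e0) (qv _ e0) (ps _ e0); apply: filterS3 => i; exact: filterS3.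
have [n nP] := ultra_homogeneous ooU UG.
pose h (k : 'I_m) := if k \in A then k : nat else (m + k)%N.
have h_inj : injective h.
  move=> k l; rewrite /h; case: ifP => _; case: ifP => _ kl; apply: val_inj => //=.
  - by move: (ltn_ord k); rewrite kl -ltn_subRL subnn.
  - by move: (ltn_ord l); rewrite -kl -ltn_subRL subnn.
  - exact: addnI kl.
have n_inj : injective n.
  by move=> i j nij; apply/eqP; case: ltngtP => // /nP[]; rewrite nij ltnn.
have ng_inj : injective (n \o h) by exact: inj_comp.
pose x := [tuple if k \in A then p (n (h k)) else q (n (h k)) | k < m].
exists (fun e : edge m => W (tnth x (val e).1, tnth x (val e).2)); split.
- by move=> d; apply: WI; rewrite tnth_mktuple; case: ifP.
- move=> [[k l] /= kl]; rewrite !tnth_mktuple /block_weights /=.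
  have lm := ltn_ord l; have km := ltn_ord k.
  rewrite /h; case: (boolP (k \in A)) => kA; case: (boolP (l \in A)) => lA /=.
  + by have [_ []] := nP _ _ kl.
  + by have [_ []] := nP _ _ (ltn_addr l km).
  (* Here [k < l] but [h l < h k]; symmetry of [W] puts the pair back in the order of the two
     limits. *)
  + by rewrite Wsym//; have [_ []] := nP _ _ (ltn_addr k lm).
  + by move: kl; rewrite -(ltn_add2l m) => /nP[_ []].
- exact: good ng_inj.
Qed.

End block_limit.

(** * Null sets of a product measure and their sections *)

Section null_sections.
Context d1 d2 (T1 : measurableType d1) (T2 : measurableType d2) (R : realType).
Variables (m1 : {sigma_finite_measure set T1 -> \bar R})
  (m2 : {sigma_finite_measure set T2 -> \bar R}).
Local Open Scope ereal_scope.

Lemma product_measure_xsection0 (A : set (T1 * T2)) : measurable A ->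
  (m1 \x m2) A = 0 <-> \forall x \ae m1, m2 (xsection A x) = 0.
Proof.
move=> mA.
have mf := measurable_fun_xsection m2 mA.
have := ae_eq_integral_abs m1 measurableT mf.
rewrite (_ : \int[m1]_x _ = (m1 \x m2) A); last first.
  by apply: eq_integral => x _; rewrite gee0_abs//= measure_ge0.
by move=> ->; split; apply: filterS => x; [exact|move=> ? _].
Qed.

(** The product measure integrates over the first factor; by uniqueness it equals [m1 \x^ m2], which
    integrates over the second. *)
Lemma product_measure_ysection0 (A : set (T1 * T2)) : measurable A ->
  (m1 \x m2) A = 0 <-> \forall y \ae m2, m1 (ysection A y) = 0.
Proof.
move=> mA.
have mf := measurable_fun_ysection m1 mA.
have := ae_eq_integral_abs m2 measurableT mf.
rewrite (_ : \int[m2]_x _ = (m1 \x m2) A); last first.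
  transitivity ((m1 \x^ m2) A); last first.
    by apply/esym/product_measure_unique => // B C mB mC; exact: product_measure2E.
  by apply: eq_integral => x _; rewrite gee0_abs//= measure_ge0.
by move=> ->; split; apply: filterS => x; [exact|move=> ? _].
Qed.

(* Fubini: otherwise [A `&` (X `*` setT)] is null. *)
Lemma ysection_positive (A : set (T1 * T2)) (X : set T1) :
  measurable A -> measurable X -> 0 < m1 X ->
  (forall x, X x -> 0 < m2 (xsection A x)) ->
  ~ \forall y \ae m2, m1 (X `&` ysection A y) = 0.
Proof.
move=> mA mX X0 XA A0.
have mAX : measurable (A `&` (X `*` setT)).
  by apply: measurableI => //; exact: measurableX.
have : (m1 \x m2) (A `&` (X `*` setT)) = 0.
  apply/product_measure_ysection0 => //; apply: filterS A0 => y <-.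
  by congr (m1 _); apply/seteqP; split => x; rewrite /ysection/= !inE/=; tauto.
move/product_measure_xsection0 => /(_ mAX)[N [mN N0 XN]].
move: X0; rewrite (_ : m1 X = 0) ?ltxx//.
apply: subset_measure0 N0 => // x Xx; apply: XN => /= xA0.
have := XA _ Xx; rewrite -xA0.
rewrite (_ : xsection _ x = xsection A x) ?ltxx//.
by apply/seteqP; split => y; rewrite /xsection/= !inE/=; tauto.
Qed.

End null_sections.

(** * Finite powers of a measure: permutations and generic histories *)

Section tuple_measure_null.
Context {d : measure_display} {T : measurableType d} {R : realType}.
Variable mu : {sigma_finite_measure set T -> \bar R}.
Local Open Scope ereal_scope.

Definition tuple_box n (A : 'I_n -> set T) : set (n.-tuple T) :=
  [set t | forall i, A i (tnth t i)].

Definition tuple_boxes n : set (set (n.-tuple T)) :=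
  [set B | exists2 A : 'I_n -> set T, forall i, measurable (A i) & B = tuple_box A].

Lemma measurable_tuple_box n (A : 'I_n -> set T) :
  (forall i, measurable (A i)) -> measurable (tuple_box A).
Proof.
move=> mA; rewrite (_ : tuple_box A = \bigcap_(i in [set: 'I_n])
    ((fun t : n.-tuple T => tnth t i) @^-1` A i)); last first.
  by apply/seteqP; split => t /= H i; [move=> _|]; exact: H.
apply: fin_bigcap_measurable => // i _.
by rewrite -[X in measurable X]setTI; exact: measurable_tnth.
Qed.

Lemma measurable_tupleE n :
  measurable = <<s @tuple_boxes n >> :> set (set (n.-tuple T)).
Proof.
apply/seteqP; split.
  apply: smallest_sub; first exact: smallest_sigma_algebra.
  move=> B; rewrite -bigcup_seq => -[i /= _ [C mC <-]].
  apply: sub_sigma_algebra.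
  exists (fun j => if j == i then C else setT).
    by move=> j; case: ifP.
  apply/seteqP; split => t /=.
    by move=> [_ Ct] j; case: eqP => // ->.
  by move=> /(_ i); rewrite eqxx.
apply: smallest_sub; first exact: sigma_algebra_measurable.
by move=> _ [A mA ->]; exact: measurable_tuple_box.
Qed.

Definition tuple_perm n (s : 'S_n) (t : n.-tuple T) : n.-tuple T :=
  [tuple tnth t (s i) | i < n].

Lemma tuple_perm_box n (s : 'S_n) (A : 'I_n -> set T) :
  tuple_perm s @^-1` tuple_box A = tuple_box (fun i => A (s^-1%g i)).
Proof.
apply/seteqP; split => t /= H i.
  by have := H (s^-1%g i); rewrite tnth_mktuple permKV.
by have := H (s i); rewrite tnth_mktuple permK.
Qed.

Lemma measurable_tuple_perm n (s : 'S_n) :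
  measurable_fun setT (tuple_perm s).
Proof.
apply: (@measurability _ _ _ _ _ _ (@tuple_boxes n)).
  by rewrite -measurable_tupleE.
move=> _ [_ [A mA ->] <-]; rewrite setTI tuple_perm_box.
exact: measurable_tuple_box.
Qed.

(** The measure and its image under the permutation both give a box the product of the measures of
    its sides. Boxes generate the measurable sets and are stable under intersection, so the two
    measures agree. *)
Lemma tuple_measure_perm n (s : 'S_n) (A : set (n.-tuple T)) :
  measurable A ->
  tuple_measure mu n (tuple_perm s @^-1` A) = tuple_measure mu n A.
Proof.
move=> mA.
have /sigma_finiteP[F [TF ndF Foo]] := sigma_finiteT mu.
have boxE B : (forall i, measurable (B i)) ->
    tuple_measure mu n (tuple_box B) = \prod_(i < n) mu (B i).
  exact: tuple_measure_box.
apply/esym.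
pose ms := pushforward (tuple_measure mu n) (tuple_perm s).
rewrite -[RHS]/(ms A).
have [nu nuE] : exists nu : {measure set (n.-tuple T) -> \bar R}, ms = nu.
  by exists (measure_function_pushforward__canonical__measure_function_Measure
    (tuple_measure mu n) (measurable_tuple_perm s)).
rewrite nuE.
apply: (measure_unique (@tuple_boxes n) (fun k => tuple_box (fun=> F k))) => //.
- exact: measurable_tupleE.
- move=> _ _ [A1 mA1 ->] [A2 mA2 ->].
  exists (fun i => A1 i `&` A2 i) => [i|]; first exact: measurableI.
  apply/seteqP; split => t /=.
    by move=> [t1 t2] i; split; [exact: t1|exact: t2].
  by move=> t12; split => i; have [] := t12 i.
- by move=> i; exists (fun=> F i) => // j; have [] := Foo i.
- apply/seteqP; split => // t _.
  have /choice[k kP] : forall i, exists k, F k (tnth t i).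
    move=> i; have [k _ Fk] : (\bigcup_k F k) (tnth t i) by rewrite -TF.
    by exists k.
  (* The sets [F k] increase, so the largest index serves all coordinates. *)
  exists (\max_i k i)%N => // i /=.
  by move: (kP i); apply/subsetPset/ndF; exact: leq_bigmax.
- move=> _ [B mB ->]; rewrite -nuE /ms /pushforward tuple_perm_box.
  rewrite /= !boxE//.
  by rewrite (reindex_inj (@perm_inj _ s^-1%g)).
- move=> k; have [mFk Fkoo] := Foo k.
  rewrite /= boxE// -ge0_fin_numE ?prode_ge0//.
  by apply: prode_fin_num => i _; rewrite ge0_fin_numE.
Qed.

Lemma ae_tuple0 (P : 0.-tuple T -> Prop) :
  (\forall t \ae tuple_measure mu 0, P t) -> P [tuple].
Proof.
move=> [N [mN N0 PN]]; apply: contrapT => nP.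
have : (\d_([tuple] : 0.-tuple T) N : \bar R) = 0 := N0.
have NT : N [tuple] by exact: PN.
by rewrite diracE mem_set//= => /eqP; rewrite onee_eq0.
Qed.

(** Fubini, read along the recursion that defines [tuple_measure]. *)
Lemma ae_tuple_cons n (P : n.+1.-tuple T -> Prop) :
  (\forall t \ae tuple_measure mu n.+1, P t) ->
  \forall x \ae mu, \forall t \ae tuple_measure mu n, P (tuple_cons (x, t)).
Proof.
move=> [N [mN N0 PN]].
have mN' : measurable (@tuple_cons _ T n @^-1` N).
  by rewrite -[X in measurable X]setTI; exact: measurable_tuple_cons.
have : (mu \x tuple_measure mu n) (@tuple_cons _ T n @^-1` N) = 0 := N0.
move/product_measure_xsection0 => /(_ mN'); apply: filterS => x Nx0.
exists (xsection (@tuple_cons _ T n @^-1` N) x); split => //.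
  exact: measurable_xsection.
by move=> t nP; rewrite /xsection/= inE; exact: PN.
Qed.

Lemma ae_tuple_perm n (s : 'S_n) (P : n.-tuple T -> Prop) :
  (\forall t \ae tuple_measure mu n, P t) ->
  \forall t \ae tuple_measure mu n, P (tuple_perm s t).
Proof.
move=> [N [mN N0 PN]]; exists (tuple_perm s @^-1` N); split.
- by rewrite -[X in measurable X]setTI; exact: measurable_tuple_perm.
- by rewrite -[RHS]N0; exact: tuple_measure_perm.
- by move=> t nP; exact: PN.
Qed.

(** There are finitely many permutations and each preserves null sets. This allows chosen points to
    be used in any order. *)
Lemma ae_tuple_perm_eq n (P : n.-tuple T -> Prop) :
  (\forall t \ae tuple_measure mu n, P t) ->
  \forall t \ae tuple_measure mu n, forall t' : n.-tuple T,
    perm_eq t' (t : n.-tuple T) -> P t'.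
Proof.
move=> aeP.
have : \forall t \ae tuple_measure mu n, forall s : 'S_n, P (tuple_perm s t).
  by apply: filter_forall => s; exact: ae_tuple_perm.
apply: filterS => t Pt t' /tuple_permP[s t'E].
by rewrite (_ : t' = tuple_perm s t)//; exact: val_inj.
Qed.

(* Unlike the plain statement [P h], this invariant survives the addition of
   almost every point to [h]. *)
Definition generic m (P : seq T -> Prop) (h : seq T) : Prop :=
  forall l n, subseq l h -> (size l + n = m)%N ->
    \forall t \ae tuple_measure mu n, P (l ++ (t : n.-tuple T)).

Lemma generic_nil m (P : seq T -> Prop) :
  (\forall t \ae tuple_measure mu m, P (t : m.-tuple T)) -> generic m P [::].
Proof. move=> aeP l n; rewrite subseq0 => /eqP->.
by rewrite add0n => nm; rewrite -nm in aeP. Qed.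

(** A subsequence of [rcons h x] either is one of [h] or is some [mask b h] followed by [x]. In the
    second case [x] takes the place of the first free coordinate, and Fubini excludes only a null
    set of [x] for each of the finitely many [b]. *)
Lemma generic_rcons m (P : seq T -> Prop) (h : seq T) :
  generic m P h -> \forall x \ae mu, generic m P (rcons h x).
Proof.
move=> gh.
have : \forall x \ae mu, forall (b : (size h).-tuple bool) n,
    (size (mask b h) + n.+1 = m)%N ->
    \forall t \ae tuple_measure mu n, P (mask b h ++ x :: (t : n.-tuple T)).
  apply: filter_forall => b.
  have [bm|mb] := ltnP (size (mask b h)) m; last first.
    apply: aeW => x n bnm; move: mb; rewrite -bnm.
    by rewrite addnS -addSn leqNgt leq_addr.
  have bmE : (size (mask b h) + (m - (size (mask b h)).+1).+1 = m)%N.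
    by rewrite addnS -addSn subnKC.
  have /ae_tuple_cons := gh (mask b h) _ (mask_subseq _ _) bmE.
  apply: filterS => x hx n bnm.
  by have /addnI[->] := etrans bnm (esym bmE).
apply: filterS => x hx l n /subseqP[b].
rewrite size_rcons; case/lastP: b => // b c; rewrite size_rcons => -[bh].
rewrite mask_rcons// => ->; case: c => /=; last first.
  by rewrite cats0; exact: gh (mask_subseq _ _).
rewrite size_cat /= addn1 addSnnS => bnm.
have := hx (tcast bh (in_tuple b)) n; rewrite val_tcast => /(_ bnm).
by apply: filterS => t; rewrite -catA.
Qed.

Lemma generic_subseq m (P : seq T -> Prop) (h l : seq T) :
  generic m P h -> subseq l h -> size l = m -> P l.
Proof.
move=> gh lh lm; have := gh l 0%N lh; rewrite addn0 => /(_ lm).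
by move/ae_tuple0; rewrite cats0.
Qed.

End tuple_measure_null.

Lemma positive_measure_ae_ex d (T : measurableType d) (R : realType)
    (mu : {measure set T -> \bar R}) (X : set T) (P : T -> Prop) :
  measurable X -> (0 < mu X)%E -> (\forall x \ae mu, P x) -> exists2 x, X x & P x.
Proof.
move=> mX X0 [N [mN N0 PN]]; apply: contrapT => /forall2NP XP.
move: X0; rewrite (_ : mu X = 0%E) ?ltxx//.
apply: subset_measure0 N0 => // x Xx; apply: PN.
by have [] := XP x.
Qed.

(** * Greedy construction of the four interleaved sequences *)

Section generic_sequence.
Context {d : measure_display} {T : measurableType d} {R : realType}.
Variable mu : {sigma_finite_measure set T -> \bar R}.

(* Positions count modulo 4 because the four sequences y, x, y', x' are
   interleaved. *)
Definition joined (E : set (T * T)) (r : nat) (h : seq T) : set T :=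
  [set x | (0 < mu (xsection E x))%E /\
    forall j, (j < size h)%N -> (j %% 4 = r)%N -> E (x, nth point h j)].

Lemma joined_rcons (E : set (T * T)) (r : nat) (h : seq T) (y : T) :
  joined E r (rcons h y) =
    if (size h %% 4 == r)%N then joined E r h `&` ysection E y else joined E r h.
Proof.
have rconsE x : (forall j, (j < size (rcons h y))%N -> (j %% 4 = r)%N ->
      E (x, nth point (rcons h y) j)) <->
    (forall j, (j < size h)%N -> (j %% 4 = r)%N -> E (x, nth point h j)) /\
    ((size h %% 4 = r)%N -> E (x, y)).
  split=> [H|[H Hy] j].
    split=> [j jh jr|hr].
      by have := H j; rewrite size_rcons nth_rcons jh; apply; rewrite // ltnW.
    by have := H (size h); rewrite size_rcons nth_rcons ltnn eqxx; exact.
  rewrite size_rcons nth_rcons ltnS leq_eqVlt => /predU1P[->|jh].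
    by rewrite ltnn eqxx.
  by rewrite jh; exact: H.
case: eqP => hr; apply/seteqP; split => x; rewrite /joined /ysection /= ?inE /=.
- by move=> [x0 /rconsE[H /(_ hr)]].
- by move=> [[x0 H] xy]; split=> //; apply/rconsE.
- by move=> [x0 /rconsE[]].
- by move=> [x0 H]; split=> //; apply/rconsE.
Qed.

Lemma measurable_joined (E : set (T * T)) (r : nat) (h : seq T) :
  measurable E -> measurable (joined E r h).
Proof.
move=> mE; elim/last_ind: h => [|h y IHh].
  rewrite (_ : joined E r [::] = setT `&` [set x | 0 < mu (xsection E x)]%E).
    by apply: measurable_lte => //; exact: measurable_fun_xsection.
  by apply/seteqP; split => x [? ?].
rewrite joined_rcons; case: ifP => // _; apply: measurableI => //.
exact: measurable_ysection.
Qed.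

Lemma joined_nil_gt0 (E : set (T * T)) (r : nat) :
  measurable E -> (0 < (mu \x mu) E)%E -> (0 < mu (joined E r [::]))%E.
Proof.
move=> mE E0; rewrite lt0e measure_ge0 andbT; apply/eqP => J0.
move: E0; rewrite (_ : (mu \x mu)%E E = 0%E) ?ltxx//.
apply/product_measure_xsection0 => //.
exists (joined E r [::]); split => //; first exact: measurable_joined.
by move=> x /= /eqP x0; split=> //; rewrite lt0e x0 measure_ge0.
Qed.

(** Points of [joined] have sections of positive measure, so [ysection_positive] applies: the [y]
    that leave a set of positive measure cannot all violate [P]. *)
Lemma joined_extend_left (E : set (T * T)) (r : nat) (h : seq T)
    (P : T -> Prop) :
  measurable E -> (0 < mu (joined E r h))%E -> (\forall y \ae mu, P y) ->
  exists2 y, P y & (0 < mu (joined E r h `&` ysection E y))%E.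
Proof.
move=> mE h0 aeP; apply: contrapT => /forall2NP H.
apply: (@ysection_positive _ _ _ _ _ mu mu E _ mE (measurable_joined r h mE) h0).
  by move=> x [].
apply: filterS aeP => y Py; apply/eqP; rewrite -measure_le0 leNgt; apply/negP.
by have [] := H y.
Qed.

(** Residues 0, 1, 2, 3 modulo 4 stand for y, x, y', x'. A new y or y' is chosen so that the set it
    cuts keeps positive measure; a new x or x' is picked in that set and cuts nothing. Almost every
    point keeps the history generic, so this can be required as well. *)
Lemma generic_sequence m (P : seq T -> Prop) (E F : set (T * T)) :
  (\forall t \ae tuple_measure mu m, P (t : m.-tuple T)) ->
  measurable E -> (0 < (mu \x mu) E)%E ->
  measurable F -> (0 < (mu \x mu) F)%E ->
  exists z : nat -> T, [/\ forall n, generic mu m P (mkseq z n),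
    forall i j, (j <= i)%N -> E (z (i * 4 + 1)%N, z (j * 4)%N) &
    forall i j, (j <= i)%N -> F (z (i * 4 + 3)%N, z (j * 4 + 2)%N)].
Proof.
move=> aeP mE E0 mF F0.
pose Inv h := [/\ generic mu m P h, (0 < mu (joined E 0 h))%E &
                  (0 < mu (joined F 2 h))%E].
pose Step h z := ((size h %% 4 = 1)%N -> joined E 0 h z) /\
                 ((size h %% 4 = 3)%N -> joined F 2 h z).
have [||z zP] := @history_choice _ Inv Step.
- by split; [exact: generic_nil|exact: joined_nil_gt0|exact: joined_nil_gt0].
- move=> h [gh Eh Fh]; have gx := generic_rcons gh.
  rewrite /Inv /Step.
  have : (size h %% 4 < 4)%N by rewrite ltn_mod.
  case hr: (size h %% 4)%N => [|[|[|[|//]]]] _.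
  + have [y gy Ey] := joined_extend_left mE Eh gx.
    by exists y; rewrite !joined_rcons hr.
  + have [x xE gy] := positive_measure_ae_ex (measurable_joined 0 h mE) Eh gx.
    by exists x; rewrite !joined_rcons hr.
  + have [y gy Fy] := joined_extend_left mF Fh gx.
    by exists y; rewrite !joined_rcons hr.
  + have [x xF gy] := positive_measure_ae_ex (measurable_joined 2 h mF) Fh gx.
    by exists x; rewrite !joined_rcons hr.
exists z; split=> [n|i j ji|i j ji]; first by have [[]] := zP n.
- have [_ [+ _]] := zP (i * 4 + 1)%N; rewrite size_mkseq modnMDl => /(_ erefl).
  move=> [_ /(_ (j * 4)%N)]; rewrite size_mkseq modnMl.
  have jlt : (j * 4 < i * 4 + 1)%N by rewrite addn1 ltnS leq_mul2r.
  by rewrite jlt nth_mkseq//; exact.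
- have [_ [_ +]] := zP (i * 4 + 3)%N; rewrite size_mkseq modnMDl => /(_ erefl).
  move=> [_ /(_ (j * 4 + 2)%N)]; rewrite size_mkseq modnMDl.
  have jlt : (j * 4 + 2 < i * 4 + 3)%N.
    by rewrite -[3%N]/(1 + 2)%N addnA ltn_add2r addn1 ltnS leq_mul2r.
  by rewrite jlt nth_mkseq//; exact.
Qed.

(** Subsequences of [mkseq z n] list their points by increasing index; the quantification over
    [perm_eq] covers the order in which [f] takes them. *)
Lemma generic_injective_tuple m (Q : m.-tuple T -> Prop) (z : nat -> T) :
  (forall n, generic mu m
    (fun l => forall t : m.-tuple T, perm_eq t l -> Q t) (mkseq z n)) ->
  forall f : 'I_m -> nat, injective f -> Q [tuple z (f k) | k < m].
Proof.
move=> gz f f_inj; pose N := (\max_k f k).+1.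
pose s := [seq i <- iota 0 N | i \in codom f].
have cs : perm_eq (codom f) s.
  apply: uniq_perm; first exact/injectiveP.
    by rewrite filter_uniq// iota_uniq.
  move=> i; rewrite mem_filter mem_iota /= add0n andbC.
  case: (boolP (i \in codom f)); rewrite ?andbF// => /codomP[k ->].
  by rewrite ltnS leq_bigmax.
apply: (generic_subseq (gz N) (l := map z s)).
- by apply: map_subseq; exact: filter_subseq.
- by rewrite size_map -(perm_size cs) size_codom card_ord.
- rewrite (_ : tval _ = map z (codom f)); first exact: perm_map.
  by rewrite -map_comp.
Qed.

End generic_sequence.

(** * Level sets of a graphon that is not a.e. constant *)

Section graphon_levels.
Context {R : realType}.
Local Notation leb := (@lebesgue_measure R).
Local Notation leb2 := (leb \x leb)%E.

Lemma measurable_unit_square : measurable (@unit_itv R `*` @unit_itv R).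
Proof. by apply: measurableX; exact: measurable_itv. Qed.

Lemma lebesgue_measure_rect (A B : set R) : measurable A -> measurable B ->
  leb2 (A `*` B) = (leb A * leb B)%E.
Proof. by move=> mA mB; exact (@product_measure1E _ _ _ _ R leb leb A B mA mB). Qed.

Definition level_le (W : R * R -> R) (c : R) : set (R * R) :=
  unit_itv `*` unit_itv `&` [set p | W p <= c].

Definition level_ge (W : R * R -> R) (c : R) : set (R * R) :=
  unit_itv `*` unit_itv `&` [set p | c <= W p].

Lemma measurable_level_le (W : R * R -> R) (c : R) :
  graphon W -> measurable (level_le W c).
Proof.
move=> [mW _ _]; apply: measurable_fun_le => //; exact: measurable_unit_square.
Qed.

Lemma measurable_level_ge (W : R * R -> R) (c : R) :
  graphon W -> measurable (level_ge W c).
Proof.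
move=> [mW _ _]; apply: measurable_fun_le => //; exact: measurable_unit_square.
Qed.

(** Otherwise [W] equals its essential infimum [sup S] almost everywhere: sublevel sets below it are
    null, and superlevel sets above it are null because some sublevel set in between is not. *)
Lemma not_ae_constant_levels (W : R * R -> R) :
  graphon W -> ~ ae_constant_graphon W ->
  exists c d : R, [/\ c < d,
    (0 < leb2 (level_le W c))%E &
    (0 < leb2 (level_ge W d))%E].
Proof.
move=> gW ncW; apply: contrapT => H; apply: ncW.
have [_ WI _] := gW.
pose lo c := level_le W c.
pose hi c := level_ge W c.
have mlo c : measurable (lo c) by exact: measurable_level_le.
have mhi c : measurable (hi c) by exact: measurable_level_ge.
have lohi c d : c < d -> leb2 (lo c) = 0%E \/ leb2 (hi d) = 0%E.
  move=> cd; apply: contrapT => /not_orP[/eqP lo0 /eqP hi0]; apply: H.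
  by exists c, d; split=> //; rewrite lt0e measure_ge0 ?lo0 ?hi0.
pose S := [set c | leb2 (lo c) = 0%E].
have S1 c : S c -> c <= 1.
  move=> Sc; rewrite leNgt; apply/negP => c1.
  have lo1 : lo c = unit_itv `*` unit_itv.
    apply/seteqP; split => [p []//|[x y] [Ix Iy]]; split => //=.
    have := WI _ _ Ix Iy; rewrite /unit_itv /= in_itv /= => /andP[_ W1].
    exact: le_trans W1 (ltW c1).
  move: Sc; rewrite /S /= lo1 lebesgue_measure_rect; [|exact: measurable_itv..].
  rewrite /unit_itv lebesgue_measure_itv /= lte_fin ltr01 oppr0 adde0 mule1.
  by move/eqP; rewrite onee_eq0.
have supS : has_sup S.
  split; last by exists 1.
  exists (-1); rewrite /S /= (_ : lo _ = set0) ?measure0//.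
  apply/seteqP; split => // -[x y] [[Ix Iy] /=].
  have := WI _ _ Ix Iy; rewrite /unit_itv /= in_itv /= => /andP[W0 _].
  by move=> /(le_trans W0); rewrite leNgt oppr_lt0 ltr01.
exists (sup S).
have Slt c : c < sup S -> S c.
  move=> cS; have [e Se ce] := sup_gt (proj1 supS) cS.
  rewrite /S /=; apply/eqP; rewrite -measure_le0.
  rewrite -[leRHS]Se; apply: le_measure; rewrite ?inE; [exact (mlo c)|exact (mlo e)|].
  by move=> p [sq /= Wc]; split => //=; exact: le_trans Wc (ltW ce).
have Sgt c : sup S < c -> leb2 (hi c) = 0%E.
  move=> Sc; have [e /andP[Se ec]] : exists e, sup S < e < c.
    by exists ((sup S + c) / 2); rewrite midf_lt// midf_lt.
  have [Se0|//] := lohi e c ec.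
  by have := ub_le_sup (proj2 supS) Se0; rewrite leNgt Se.
(* Levels at distance 1/(n+1) write both strict inequalities as countable unions of null sets. *)
have lo_null n : leb2.-negligible (lo (sup S - n.+1%:R^-1)).
  apply/negligibleP; first exact (mlo _).
  by apply: Slt; rewrite ltrBlDr ltrDl invr_gt0.
have hi_null n : leb2.-negligible (hi (sup S + n.+1%:R^-1)).
  apply/negligibleP; first exact (mhi _).
  by apply: Sgt; rewrite ltrDl invr_gt0.
have := negligibleU (negligible_bigcup lo_null) (negligible_bigcup hi_null).
apply: negligibleS => -[x y] /= /not_implyP[Ix /not_implyP[Iy]].
move=> /eqP; rewrite neq_lt => /orP[WS|SW]; [left|right].
  have d0 : 0 < sup S - W (x, y) by rewrite subr_gt0.
  have [n /= nd] := filter_ex (near_infty_natSinv_lt (PosNum d0)).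
  by exists n => //; split => //=; rewrite lerBrDr -lerBrDl ltW.
have d0 : 0 < W (x, y) - sup S by rewrite subr_gt0.
have [n /= nd] := filter_ex (near_infty_natSinv_lt (PosNum d0)).
by exists n => //; split => //=; rewrite -lerBrDl ltW.
Qed.

End graphon_levels.

(** * The graphon with two blocks cut at 1/2 *)

Section two_block.
Context {R : realType}.
Variables (u v s : R).
Local Notation leb := (@lebesgue_measure R).

Definition two_block (p : R * R) : R :=
  if (p.1 <= 2^-1) && (p.2 <= 2^-1) then u
  else if ~~ (p.1 <= 2^-1) && ~~ (p.2 <= 2^-1) then v else s.

Lemma two_block_graphon :
  unit_itv u -> unit_itv v -> unit_itv s -> graphon two_block.
Proof.
move=> uI vI sI.
have m1 D : measurable_fun D (fun p : R * R => p.1 <= 2^-1).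
  by apply: measurable_realfun.measurable_fun_ler => //;
    apply: measurable_funS measurable_fst.
have m2 D : measurable_fun D (fun p : R * R => p.2 <= 2^-1).
  by apply: measurable_realfun.measurable_fun_ler => //;
    apply: measurable_funS measurable_snd.
split.
- have mI := @measurable_unit_square R.
  have m12 D := measurable_and (m1 D) (m2 D).
  apply: measurable_fun_if (m12 _) _ _ => //.
  apply: measurable_fun_if => //; first exact: m12.
  by apply: measurable_and; apply: measurable_neg.
- by move=> x y _ _; rewrite /two_block; case: ifP => // _; case: ifP.
- by move=> x y _ _; rewrite /two_block /= andbC [X in if X then v else _]andbC.
Qed.

Lemma Phi_two_block m (Phi : {ptws edge m -> R} -> R) (x : m.-tuple R) :
  Phi_graphon Phi two_block x =
    Phi (block_weights u v s [set k | tnth x k <= 2^-1]%SET).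
Proof.
rewrite /Phi_graphon; congr Phi; apply/funext => e.
by rewrite /two_block /block_weights /= !inE.
Qed.

Let half01 : (0 < 2^-1 :> R) * (2^-1 < 1 :> R).
Proof. by rewrite invr_gt0 ltr0n invf_lt1 ?ltr1n. Qed.

Lemma two_block_two_type : graphon two_block -> two_type_graphon two_block.
Proof.
move=> gW; split=> //.
exists (fun i : 'I_2 => if i == ord0 then `[0, 2^-1]%classic else `]2^-1, 1]%classic).
split.
- by move=> i; case: ifP => _; exact: measurable_itv.
- apply/trivIsetP => i j _ _.
  case: (unliftP ord0 i) => [i'|] ->; case: (unliftP ord0 j) => [j'|] -> //=.
  + by rewrite (ord1 i') (ord1 j') eqxx.
  + move=> _; apply/seteqP; split=> // x [] /=; rewrite !in_itv /=.
    by move=> /andP[+ _] /andP[_]; rewrite ltNge => /negP.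
  + move=> _; apply/seteqP; split=> // x [] /=; rewrite !in_itv /=.
    by move=> /andP[_ +] /andP[+ _]; rewrite ltNge => -> .
- apply/seteqP; split=> x.
    move=> [i _]; rewrite /unit_itv; case: ifP => _ /=; rewrite !in_itv /=.
      by move=> /andP[-> /le_trans->//]; rewrite ltW// half01.
    by move=> /andP[/ltW + ->]; rewrite andbT; apply: le_trans; rewrite ltW// half01.
  rewrite /unit_itv /= in_itv /= => /andP[x0 x1].
  have [xh|xh] := leP x 2^-1; first by exists ord0 => //=; rewrite in_itv /= x0.
  by exists ord_max => //=; rewrite in_itv /= x1 andbT.
- move=> i j.
  have itvE (k : 'I_2) (x : R) :
      (if k == ord0 then `[0, 2^-1]%classic else `]2^-1, 1]%classic) x ->
      (x <= 2^-1) = (k == ord0).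
    case: ifP => _ /=; rewrite in_itv /=; first by move=> /andP[].
    by rewrite ltNge => /andP[/negPf].
  exists (if (i == ord0) && (j == ord0) then u
          else if (i != ord0) && (j != ord0) then v else s) => x y xi yj.
  by rewrite /two_block /= (itvE i x xi) (itvE j y yj).
Qed.

(** The low-low, high-high and low-high rectangles have positive measure, so each contains a point
    where the value is [c]; these values are [u], [v] and [s]. *)
Lemma two_block_not_ae_constant :
  ~ (u = v /\ v = s) -> ~ ae_constant_graphon two_block.
Proof.
move=> uvs [c aec]; apply: uvs.
have pick (I J : interval R) : (0 < leb [set` I])%E -> (0 < leb [set` J])%E ->
    [set` I] `<=` unit_itv -> [set` J] `<=` unit_itv ->
    exists x y, [/\ x \in I, y \in J & two_block (x, y) = c].
  move=> I0 J0 IU JU.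
  have mI : measurable [set` I] by exact: measurable_itv.
  have mJ : measurable [set` J] by exact: measurable_itv.
  have mIJ : measurable ([set` I] `*` [set` J]) by exact: measurableX.
  have IJ0 : (0 < (leb \x leb) ([set` I] `*` [set` J]))%E.
    by rewrite lebesgue_measure_rect// mule_gt0.
  have [[x y] [/= xI yJ] cxy] :=
    @positive_measure_ae_ex _ _ R (leb \x leb)%E _ _ mIJ IJ0 aec.
  by exists x, y; split=> //; apply: cxy; [exact: IU|exact: JU].
have lowU : `[0, 2^-1]%classic `<=` @unit_itv R.
  move=> x; rewrite /unit_itv /= !in_itv /= => /andP[-> /le_trans->//].
  by rewrite ltW// half01.
have highU : `]2^-1, 1]%classic `<=` @unit_itv R.
  move=> x; rewrite /unit_itv /= !in_itv /= => /andP[/ltW + ->].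
  by rewrite andbT; apply: le_trans; rewrite ltW// half01.
have low0 : (0 < leb [set` `[0, 2^-1]%R])%E.
  by rewrite lebesgue_measure_itv /= lte_fin half01 -EFinB lte_fin subr0 half01.
have high0 : (0 < leb [set` `]2^-1, 1]%R])%E.
  by rewrite lebesgue_measure_itv /= lte_fin half01 -EFinB lte_fin subr_gt0 half01.
have [x [y []]] := pick _ _ low0 low0 lowU lowU.
rewrite !in_itv /two_block /= => /andP[_ ->] /andP[_ ->] /= ->.
have {x y}[x [y []]] := pick _ _ high0 high0 highU highU.
rewrite !in_itv /two_block /= !ltNge => /andP[/negPf-> _] /andP[/negPf-> _] /= ->.
have {x y}[x [y []]] := pick _ _ low0 high0 lowU highU.
by rewrite !in_itv /two_block /= !ltNge => /andP[_ ->] /andP[/negPf-> _] /= ->.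
Qed.

End two_block.

(** * The implications between the three statements *)

Section implications.
Context {R : realType} (m : nat) (Phi : {ptws edge m -> R} -> R) (a : R).
Local Notation leb := (@lebesgue_measure R).

Definition block_solution (u v s : R) : Prop :=
  [/\ unit_itv u, unit_itv v & unit_itv s] /\
  forall A : {set 'I_m}, Phi (block_weights u v s A) = a.

(** With one point in each part, the tuple equal to [x0] on [A] and to [x1] elsewhere yields the
    equation for [A]. An empty part would make [W] constant. *)
Lemma two_type_block_solution (W : R * R -> R) :
  two_type_graphon W ->
  (forall x : m.-tuple R,
     (forall k, unit_itv (tnth x k)) -> Phi_graphon Phi W x = a) ->
  ~ constant_graphon W ->
  exists u v s : R, block_solution u v s /\ ~ (u = v /\ v = s).
Proof.
move=> [[_ WI Wsym] [S [_ _ SU SW]]] Wa ncW.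
have S2 x : unit_itv x -> S ord0 x \/ S ord_max x.
  rewrite -SU => -[i _]; case: (unliftP ord0 i) => [j|] ->; last by left.
  by right; rewrite (_ : ord_max = lift ord0 j)//; apply: val_inj; rewrite /= (ord1 j).
have Sne i j : (forall x, unit_itv x -> S i x \/ S j x) -> S i !=set0.
  move=> Sij; apply: contrapT => /set0P/negP/negPn/eqP Si0; apply: ncW.
  have [c jc] := SW j j; exists c => x y Ix Iy; apply: jc.
    by have [] := Sij _ Ix; rewrite ?Si0.
  by have [] := Sij _ Iy; rewrite ?Si0.
have [x0 Sx0] : S ord0 !=set0 by exact: Sne S2.
have [x1 Sx1] : S ord_max !=set0.
  by apply: (Sne _ ord0) => x /S2[]; [right|left].
have SI i x : S i x -> unit_itv x by move=> Six; rewrite -SU; exists i.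
have Ix0 := SI _ _ Sx0; have Ix1 := SI _ _ Sx1.
have SWE i j x y x' y' : S i x -> S j y -> S i x' -> S j y' ->
    W (x, y) = W (x', y').
  by have [c ijc] := SW i j; move=> *; rewrite !ijc.
exists (W (x0, x0)), (W (x1, x1)), (W (x0, x1)); split.
  split=> [|A]; first by split; exact: WI.
  rewrite -(Wa [tuple if k \in A then x0 else x1 | k < m]); last first.
    by move=> k; rewrite tnth_mktuple; case: ifP.
  rewrite /Phi_graphon; congr Phi; apply/funext => -[[k l] kl].
  rewrite /block_weights /= !tnth_mktuple.
  by case: (k \in A); case: (l \in A) => //=; rewrite Wsym.
move=> [W01 W1s]; apply: ncW; exists (W (x0, x0)) => x y Ix Iy.
have [Sx|Sx] := S2 _ Ix; have [Sy|Sy] := S2 _ Iy.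
- exact: (SWE _ _ _ _ _ _ Sx Sy Sx0 Sx0).
- by rewrite W01 W1s; exact: (SWE _ _ _ _ _ _ Sx Sy Sx0 Sx1).
- by rewrite W01 W1s (Wsym x y)//; exact: (SWE _ _ _ _ _ _ Sy Sx Sx0 Sx1).
- by rewrite W01; exact: (SWE _ _ _ _ _ _ Sx Sy Sx1 Sx1).
Qed.

Lemma ae_graphon_block_solution (W : R * R -> R) :
  {within weight_cube m, continuous Phi} -> graphon W ->
  {ae tuple_measure leb m, forall x : m.-tuple R,
     (forall k, unit_itv (tnth x k)) -> Phi_graphon Phi W x = a} ->
  ~ ae_constant_graphon W ->
  exists u v s : R, block_solution u v s /\ ~ (u = v /\ v = s).
Proof.
move=> cPhi gW aeW ncW.
have [_ WI Wsym] := gW.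
have [c [d [cd Wc Wd]]] := not_ae_constant_levels gW ncW.
have mWc := measurable_level_le c gW.
have mWd := measurable_level_ge d gW.
pose Q (t : m.-tuple R) :=
  (forall k, unit_itv (tnth t k)) -> Phi_graphon Phi W t = a.
pose P (l : seq R) := forall t : m.-tuple R, perm_eq t l -> Q t.
have [z [gz zc zd]] := @generic_sequence _ _ _ leb m P _ _
  (ae_tuple_perm_eq aeW) mWc Wc mWd Wd.
have good := generic_injective_tuple gz.
have zI n : unit_itv (z n).
  rewrite (divn_eq n 4); have : (n %% 4 < 4)%N by rewrite ltn_mod.
  have [[Iz1 Iz0] _] := zc _ _ (leqnn (n %/ 4)).
  have [[Iz3 Iz2] _] := zd _ _ (leqnn (n %/ 4)).
  by case: (n %% 4)%N => [|[|[|[|//]]]] //; rewrite addn0.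
have [U [UU ooU]] := ultraFilterLemma (@eventually_filter).
have limW (p q : nat) : exists2 L : R, unit_itv L & forall e, 0 < e ->
    \forall i \near U, \forall j \near U,
      `|W (z (i * 4 + p)%N, z (j * 4 + q)%N) - L| < e.
  by apply: ultra_iterated_limit => i j; exact: WI.
have sol p q u v s : (p < 4)%N -> (q < 4)%N ->
    unit_itv u -> unit_itv v -> unit_itv s ->
    (forall e, 0 < e -> \forall i \near U, \forall j \near U,
      `|W (z (i * 4 + p)%N, z (j * 4 + p)%N) - u| < e) ->
    (forall e, 0 < e -> \forall i \near U, \forall j \near U,
      `|W (z (i * 4 + q)%N, z (j * 4 + q)%N) - v| < e) ->
    (forall e, 0 < e -> \forall i \near U, \forall j \near U,
      `|W (z (i * 4 + p)%N, z (j * 4 + q)%N) - s| < e) ->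
    block_solution u v s.
  move=> p4 q4 uI vI sI pu qv pqs; split=> //.
  apply: (@Phi_block_weights_limit _ _ _ cPhi _ _ gW U UU ooU
    (fun i => z (i * 4 + p)%N) (fun i => z (i * 4 + q)%N)) => // A g g_inj.
  (* [r k] is the residue of the sequence that serves position [k]; division by 4 recovers [g k], so
     the indices into [z] are distinct. *)
  pose r k := if k \in A then p else q.
  have rlt k : (r k < 4)%N by rewrite /r; case: ifP.
  have f_inj : injective (fun k => g k * 4 + r k)%N.
    move=> k l /(congr1 (divn ^~ 4)); rewrite !divnMDl// !divn_small//.
    by rewrite !addn0 => /g_inj.
  have := good _ f_inj.
  rewrite (_ : [tuple _ | k < m] =
    [tuple if k \in A then z (g k * 4 + p)%N else z (g k * 4 + q)%N | k < m]).
    by apply => k; rewrite tnth_mktuple; case: ifP.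
  by apply: eq_mktuple => k; rewrite /r; case: ifP.
(* From here [y], [x], [y'], [x'] are the limits of [W] inside each sequence, and [s], [s'], [t]
   those between y and x, y' and x', x and x'. *)
have [y yI Ly] := limW 0%N 0%N.
have [x xI Lx] := limW 1%N 1%N.
have [y' y'I Ly'] := limW 2 2.
have [x' x'I Lx'] := limW 3 3.
have [s sI Ls] := limW 0%N 1%N.
have [s' s'I Ls'] := limW 2 3.
have [t tI Lt] := limW 1%N 3.
have sol1 : block_solution y x s by exact: (sol 0%N 1%N).
have sol2 : block_solution y' x' s' by exact: (sol 2 3).
have sol3 : block_solution x x' t by exact: (sol 1%N 3).
(* [U] contains the tails, so [j] can be taken at least [i], where the bounds [zc] and [zd] apply
   after exchanging the arguments of [W]. *)
have exij (D : nat -> nat -> Prop) :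
    (\forall i \near U, \forall j \near U, D i j) ->
    exists i j, (i <= j)%N /\ D i j.
  move=> /filter_ex[i UD].
  have [j [Dij ij]] := filter_ex (filterI UD (ooU _ (nbhs_infty_ge i))).
  by exists i, j.
have sc : s <= c.
  apply/ler_addgt0Pr => e /Ls/exij[i [j [/zc[_ /= Wij]]]].
  rewrite addn0 -Wsym// ltr_distlC => /andP[_ /ltW/le_trans]; apply.
  by rewrite lerD2r.
have s'd : d <= s'.
  apply/ler_addgt0Pr => e /Ls'/exij[i [j [/zd[_ /= Wij]]]].
  rewrite -Wsym// ltr_distl => /andP[_ /ltW].
  by apply: le_trans.
have [[yx xs]|] := pselect (y = x /\ x = s); last by exists y, x, s.
have [[y'x' x's']|] := pselect (y' = x' /\ x' = s'); last by exists y', x', s'.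
(* In this case [x = s] and [x' = s'], so [x = x'] would contradict [s <= c < d <= s']. *)
exists x, x', t; split=> // -[xx' _].
by move: cd; rewrite ltNge (le_trans s'd)// -x's' -xx' xs.
Qed.

End implications.

Theorem theorem5p2 (R : realType) (m : nat) (hm : (2 <= m)%N)
    (Phi : {ptws edge m -> R} -> R)
    (hPhi : {within weight_cube m, continuous Phi}) (a : R) :
  let i := exists W : R * R -> R,
    [/\ graphon W,
        {ae tuple_measure lebesgue_measure m, forall x : m.-tuple R,
           (forall k, unit_itv (tnth x k)) -> Phi_graphon Phi W x = a} &
        ~ ae_constant_graphon W] in
  let ii := exists W : R * R -> R,
    [/\ two_type_graphon W,
        (forall x : m.-tuple R,
           (forall k, unit_itv (tnth x k)) -> Phi_graphon Phi W x = a) &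
        ~ constant_graphon W] in
  let iii := exists u v s : R,
    [/\ [/\ unit_itv u, unit_itv v & unit_itv s],
        ~ (u = v /\ v = s) &
        forall A : {set 'I_m}, Phi (block_weights u v s A) = a] in
  (i <-> ii) /\ (ii <-> iii).
Proof.
move=> i ii iii.
have i_iii : i -> iii.
  move=> [W [gW aeW ncW]].
  have [u [v [s [[? ?] ?]]]] := ae_graphon_block_solution hPhi gW aeW ncW.
  by exists u, v, s.
have ii_iii : ii -> iii.
  move=> [W [tW Wa ncW]].
  have [u [v [s [[? ?] ?]]]] := two_type_block_solution tW Wa ncW.
  by exists u, v, s.
(* One graphon serves both: its equation holds at every tuple, and a constant graphon would be a.e.
   constant. *)
have iii_i_ii : iii -> i /\ ii.
  move=> [u [v [s [[uI vI sI] uvs Phia]]]].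
  have gW := two_block_graphon uI vI sI.
  have ncW := two_block_not_ae_constant uvs.
  have Wa x : Phi_graphon Phi (two_block u v s) x = a by rewrite Phi_two_block.
  split; exists (two_block u v s); split=> //.
  - by apply: aeW => x _; exact: Wa.
  - exact: two_block_two_type.
  - move=> [c Wc]; apply: ncW; exists c.
    by apply: aeW => -[x y] /=; exact: Wc.
split; split.
- by move=> /i_iii/iii_i_ii[].
- by move=> /ii_iii/iii_i_ii[].
- exact: ii_iii.
- by move=> /iii_i_ii[].
Qed.
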